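(* Let $b\in\mathbb{N}$ and let $S$ and $W$ be two $b$-weakly right cancellative semigroups, each having an identity element, with given nets $\mathcal{E}$ in $\mathcal{P}_f(S)$ and $\mathcal{F}$ in $\mathcal{P}_f(W)$. Let $A\subseteq S$ and $B\subseteq W$. Then $A\times B$ is a $D$-set with respect to $\mathcal{E}*\mathcal{F}$ in $S\times W$ if and only if $A$ is a $D$-set with respect to $\mathcal{E}$ in $S$ and $B$ is a $D$-set with respect to $\mathcal{F}$ in $W$.
   Context: Semigroups are nonempty and discrete; $\mathbb{N}=\{1,2,\dots\}$; $\mathcal{P}_f(X)$ is the set of finite nonempty subsets of $X$. $\beta S$ is the space of ultrafilters on $S$ (Stone–Čech compactification), with basic open sets $\overline{A}=\{p\in\beta S: A\in p\}$ for $A\subseteq S$, and semigroup operation $pq=\{A\subseteq S:\{s\in S: s^{-1}A\in q\}\in p\}$, where $s^{-1}A=\{t\in S: st\in A\}$. For a net $\mathcal{F}=\langle F_i\rangle_{i\in I}$ in $\mathcal{P}_f(S)$ ($I$ a directed set) and $A\subseteq S$, the upper Banach density of $A$ with respect to $\mathcal{F}$ is $$d_{\mathcal{F}}^*(A)=\sup\{\alpha: (\forall i_0\in I)(\exists i\geq i_0)(\exists s\in S\cup\{1\})(|A\cap(F_i\cdot s)|\geq\alpha|F_i|)\},$$ where $F_i\cdot 1$ means $F_i$. Put $D_{\mathcal{F}}^*=\{p\in\beta S:(\forall A\in p)(d_{\mathcal{F}}^*(A)>0)\}$. A subset $A\subseteq S$ is a $D$-set with respect to $\mathcal{F}$ if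 $A\in p$ for some idempotent $p$ ($pp=p$) of $\beta S$ with $p\in D_{\mathcal{F}}^*$. $S$ is $b$-weakly right cancellative if for all $t,u\in S$, $|\{s\in S: st=u\}|\leq b$. For nets $\mathcal{E}=\langle E_i\rangle_{i\in I}$ in $\mathcal{P}_f(S)$ and $\mathcal{F}=\langle F_j\rangle_{j\in J}$ in $\mathcal{P}_f(W)$, the product net in $\mathcal{P}_f(S\times W)$ (with $S\times W$ the direct product semigroup) is $\mathcal{E}*\mathcal{F}=\langle E_i\times F_j\rangle_{(i,j)\in I\times J}$, where $(i_1,j_1)\geq(i_0,j_0)$ iff $i_1\geq i_0$ and $j_1\geq j_0$. *)

(* Defs.v *)
From mathcomp Require Import all_boot all_order all_algebra finmap.
From mathcomp Require Import boolp classical_sets functions cardinality filter.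
From mathcomp Require Import reals.

Set Implicit Arguments.
Unset Strict Implicit.
Unset Printing Implicit Defensive.

Import Order.TTheory GRing.Theory Num.Theory.

Local Open Scope classical_set_scope.
Local Open Scope ring_scope.

(* Inhabitation is part of the definition: over an empty index type every set
   would have upper Banach density +oo. *)
Definition directed d (I : preorderType d) : Prop :=
  inhabited I /\ forall i j : I, exists k : I, (i <= k)%O /\ (j <= k)%O.

Definition net_Pf d (I : preorderType d) (T : choiceType) (F : I -> {fset T}) :
  Prop := directed I /\ forall i, F i != fset0.

Definition product_net d d' (I : preorderType d) (J : preorderType d')
    (S W : choiceType) (E : I -> {fset S}) (F : J -> {fset W}) :
    I *p J -> {fset (S * W)%type} :=
  fun ij => (E ij.1 `*` F ij.2)%fset.

(* The cardinal comparison is [#<=] because the fibre is not known beforehand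
   to be finite. *)
Definition weakly_right_cancellative (b : nat) (S : semigroupType) : Prop :=
  forall t u : S, ([set s : S | (s * t)%g = u] #<= `I_b)%card.

(* [option S] encodes S with a formal identity adjoined, [None] being that
   identity. *)
Definition rtranslate (S : semigroupType) (F : {fset S}) (s : option S) :
    {fset S} :=
  if s is Some t then [fset (x * t)%g | x in F]%fset else F.

Section Density.
Context (R : realType) (S : semigroupType) (d : Order.disp_t)
        (I : preorderType d) (F : I -> {fset S}).

Definition upper_Banach_levels (A : set S) : set R :=
  [set alpha : R | forall i0 : I, exists i : I, (i0 <= i)%O /\
    exists s : option S,
      alpha * #|` F i|%:R <=
        #|` [fset x in rtranslate (F i) s | x \in A]%fset|%:R].

Definition upper_Banach_density (A : set S) : R := sup (upper_Banach_levels A).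

(* [sup] on R is a junk value for sets that are empty or unbounded; it is the
   genuine supremum here. *)
Lemma has_sup_upper_Banach_levels (A : set S) :
  net_Pf F -> has_sup (upper_Banach_levels A).
Proof.
move=> [[[i0] _] F0]; split.
  by exists 0 => i; exists i; split=> //; exists None; rewrite mul0r ler0n.
exists 1 => alpha /(_ i0)[i [_ [s le_alpha]]].
have Fi_gt0 : (0 < #|` F i|)%N by rewrite cardfs_gt0.
rewrite -(@ler_pM2r _ #|` F i|%:R) ?ltr0n// mul1r (le_trans le_alpha)// ler_nat.
apply: (@leq_trans #|` rtranslate (F i) s|).
  by apply/fsubset_leq_card/fsubsetP => x; rewrite !inE => /andP[].
by case: s {le_alpha} => [t|] //=; exact: leq_imfset_card.
Qed.

Definition Dstar : set (set_system S) :=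
  [set p | UltraFilter p /\
           forall A : set S, p A -> 0 < upper_Banach_density A].

End Density.

(* Points of the Stone-Cech compactification of the discrete semigroup S are
   the p : set_system S such that UltraFilter p. *)
Definition ultra_mul (S : semigroupType) (p q : set_system S) : set_system S :=
  [set A : set S | p [set s : S | q [set t : S | A (s * t)%g]]].

Definition Dset (R : realType) (S : semigroupType) d (I : preorderType d)
    (F : I -> {fset S}) (A : set S) : Prop :=
  exists p : set_system S,
    [/\ UltraFilter p, ultra_mul p p = p, Dstar R F p & p A].

(* Main.v *)
Require Import Defs.
From mathcomp Require Import all_boot all_order all_algebra finmap.
From mathcomp Require Import boolp classical_sets functions cardinality filter.
From mathcomp Require Import reals.

Set Implicit Arguments.
Unset Strict Implicit.
Unset Printing Implicit Defensive.

Import Order.TTheory GRing.Theory Num.Theory.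

Local Open Scope classical_set_scope.
Local Open Scope ring_scope.

(* From left to right, push the idempotent forward along the projections: a
   trace of [C `*` setT] on a translate of [E i `*` F j] has at most the
   relative size of a trace of [C] on a translate of [E i].
   Conversely, let [p] and [q] be the given idempotents. Products of sets of
   positive density have positive density and the null sets form an ideal, so
   the ultrafilters in [D*] of the product net projecting to [p] and [q] form a
   nonempty closed set. It is a subsemigroup: [p] and [q] are idempotent, and by
   weak right cancellation [D*] is a right ideal. Ellis' lemma then yields an
   idempotent in it. *)

(** * Ultrafilters and the filters they refine *)

Lemma ultra_decisive (T : Type) (p : set_system T) :
  ProperFilter p -> (forall A : set T, p A \/ p (~` A)) -> UltraFilter p.
Proof.
move=> pP pC; split=> // G GP pG; apply/seteqP; split=> // A GA.
have [//|/pG GnA] := pC A; exfalso.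
by apply: (filter_not_empty G); rewrite -(setICr A); exact: filterI.
Qed.

Lemma ultra_disjoint (T : Type) (p : set_system T) (A : set T) :
  ProperFilter p -> p A -> p (~` A) -> False.
Proof.
move=> pP pA pnA; apply: (filter_not_empty p).
by rewrite -(setICr A); exact: filterI.
Qed.

(** If [A] is not in [G], then [G] and the complement of [A] generate a proper filter, and an
    ultrafilter refining it omits [A]. *)
Lemma filter_ultraP (T : Type) (G : set_system T) (A : set T) : Filter G ->
  (forall r, UltraFilter r -> G `<=` r -> r A) -> G A.
Proof.
move=> GF GrA; apply: contrapT => nGA.
have GnA : ProperFilter (filter_from G (fun B => B `&` ~` A)).
  apply: filter_from_proper.
    apply: filter_from_filter; first by exists setT; exact: filterT.
    move=> B C GB GC; exists (B `&` C); first exact: filterI.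
    by move=> x [[Bx Cx] nAx].
  move=> B GB; apply: contrapT => BA0; apply: nGA.
  by apply: filterS GB => x Bx; apply: contrapT => nAx; apply: BA0; exists x.
have [r [rU Gr]] := ultraFilterLemma GnA.
apply: (@ultra_disjoint _ r A).
- by apply: GrA => // B GB; apply: Gr; exists B => // x [].
- by apply: Gr; exists setT; [exact: filterT|move=> x []].
Qed.

Lemma fmap_ultra (T U : Type) (f : T -> U) (p : set_system T) :
  UltraFilter p -> UltraFilter (f @ p).
Proof.
move=> pU; apply: ultra_decisive => A.
exact: (in_ultra_setVsetC (f @^-1` A) pU).
Qed.

(** * Products of ultrafilters and Ellis' lemma, with filters in place of closed sets *)

Section UltraMul.
Variable S : semigroupType.
Implicit Types (p q r M G : set_system S).

Lemma ultra_mul_filter p q : Filter p -> Filter q -> Filter (ultra_mul p q).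
Proof.
move=> pF qF; split=> [|A B|A B AB].
- by apply: (@filterE _ p) => s; exact: filterT.
- by apply: (@filterS2 _ p) => s; exact: filterI.
- by apply: (@filterS _ p) => s; apply: filterS => t /AB.
Qed.

Lemma ultra_mul_proper p q :
  ProperFilter p -> ProperFilter q -> ProperFilter (ultra_mul p q).
Proof.
move=> pF qF; split; last exact: ultra_mul_filter.
by move=> /(@filter_ex _ p)[s] /filter_ex[t].
Qed.

Lemma ultra_mul_ultra p q :
  UltraFilter p -> UltraFilter q -> UltraFilter (ultra_mul p q).
Proof.
move=> pU qU; apply: ultra_decisive => [|A]; first exact: ultra_mul_proper.
have [pA|pnA] := in_ultra_setVsetC [set s | q [set t | A (s * t)%g]] pU.
  by left.
right; apply: (@filterS _ p) pnA => s /= nqA.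
by have [//|] := in_ultra_setVsetC [set t | A (s * t)%g] qU.
Qed.

Lemma ultra_mulA p q r :
  ultra_mul (ultra_mul p q) r = ultra_mul p (ultra_mul q r).
Proof.
rewrite predeqE => A; rewrite /ultra_mul/=.
suff -> : (fun s => q [set t | r [set u | A (s * t * u)%g]]) =
          (fun s => q [set t | r [set u | A (s * (t * u))%g]]) by [].
rewrite funeqE => s; congr q; rewrite funeqE => t /=; congr r.
by rewrite funeqE => u /=; rewrite mulgA.
Qed.

(* A proper filter [G] stands for the nonempty closed set of the ultrafilters
   that refine it; this says that this set is a subsemigroup. *)
Definition semigroup_filter G : Prop :=
  ProperFilter G /\ forall p q, UltraFilter p -> UltraFilter q ->
    G `<=` p -> G `<=` q -> G `<=` ultra_mul p q.

(* For ultrafilters [q] and [r], the ultrafilters refining it are the [p]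
   refining [M] with [p q = r]. *)
Definition rdiv_filter M q r : set_system S :=
  filter_from [set BA : set S * set S | M BA.1 /\ r BA.2]
    (fun BA => BA.1 `&` [set s | q [set t | BA.2 (s * t)%g]]).

(** If some generator were empty, say from [B] in [M] and [A] in [r], the complement of [A] would
    lie in [M q], hence in [r]. *)
Lemma rdiv_filter_proper M q r : ProperFilter M -> UltraFilter q ->
  UltraFilter r -> ultra_mul M q `<=` r -> ProperFilter (rdiv_filter M q r).
Proof.
move=> MP qU rU Mqr; apply: filter_from_proper.
  apply: filter_from_filter.
    by exists (setT, setT); split; exact: filterT.
  move=> [B A] [B' A'] [/= MB rA] [/= MB' rA'].
  exists (B `&` B', A `&` A') => /=; first by split; exact: filterI.
  move=> s [[Bs B's] qAA'] /=.
  by split; split=> //; apply: filterS qAA' => t [].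
move=> [B A] [/= MB rA]; apply: contrapT => BA0.
apply: (@ultra_disjoint _ r A) => //; apply: Mqr; rewrite /ultra_mul/=.
apply: filterS MB => s Bs.
have [qA|//] := in_ultra_setVsetC [set t | A (s * t)%g] qU.
by exfalso; apply: BA0; exists s.
Qed.

Lemma rdiv_filter_sub M q r : UltraFilter r -> M `<=` rdiv_filter M q r.
Proof.
move=> rU B MB; exists (B, setT); last by move=> s [].
by split=> //; exact: filterT.
Qed.

Lemma rdiv_filter_mul M q r p : Filter M -> Filter p ->
  rdiv_filter M q r `<=` p -> r `<=` ultra_mul p q.
Proof.
move=> MF pF Mp A rA; apply: Mp; exists (setT, A); last by move=> s [].
by split=> //; exact: filterT.
Qed.

(** A maximal filter is a minimal closed subsemigroup. Zorn's lemma applies: an ultrafilter refining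
    the union of a chain refines every member, and each set of the union lies in one member. *)
Lemma max_semigroup_filter G : semigroup_filter G ->
  exists M, [/\ semigroup_filter M, G `<=` M &
    forall K, semigroup_filter K -> M `<=` K -> K = M].
Proof.
(* Joining [G] to [H] makes the empty chain harmless: its union then yields [G]. *)
move=> GS; pose P := [set H : set_system S | semigroup_filter (G `|` H)].
have [C CP Ctot|H [HP Hmax]] := @Zorn_bigcup _ P.
  rewrite /P/=; set U := G `|` _.
  have sub X : U X -> exists K, [/\ semigroup_filter K, K `<=` U, K X &
      K = G \/ exists2 H, C H & K = G `|` H].
    move=> [GX|[H CH HX]].
      by exists G; split=> //; [move=> Y GY; left|left].
    exists (G `|` H); split=> //; [exact: CP| |by right|by right; exists H].
    by move=> Y [GY|HY]; [left|right; exists H].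
  have sub2 X Y : U X -> U Y ->
      exists K, [/\ semigroup_filter K, K `<=` U, K X & K Y].
    move=> /sub[K [KS KU KX KC]] /sub[L [LS LU LY LC]].
    suff [KL|LK] : K `<=` L \/ L `<=` K.
    - by exists L; split=> //; exact: KL.
    - by exists K; split=> //; exact: LK.
    case: KC => [->|[H CH ->]].
      by left; case: LC => [->//|[H CH ->] Z GZ]; left.
    case: LC => [->|[H' CH' ->]]; first by right => Z GZ; left.
    by have [HH'|HH'] := Ctot _ _ CH CH'; [left|right] => Z [GZ|HZ];
      by [left|right; exact: HH'].
  split; last first.
    move=> p q pU qU Up Uq X /sub[K [[_ KS] KU KX _]].
    by apply: KS KX => // Y /KU; [exact: Up|exact: Uq].
  have UF : Filter U.
    split.
    - by left; case: GS => GP _; exact: filterT.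
    - move=> X Y UX UY; have [K [[KP _] KU KX KY]] := sub2 X Y UX UY.
      by apply: KU; exact: filterI.
    - move=> X Y XY /sub[K [[KP _] KU KX _]].
      by apply: KU; exact: filterS KX.
  by split=> // /sub[K [[KP _] _ K0 _]]; exact: (filter_not_empty K).
exists (G `|` H); split; [exact: HP|by move=> X; left|].
move=> K KS HK; apply/seteqP; split=> //; apply: contrapT => nKH.
apply: (Hmax K).
  by split=> [X HX|KH]; [apply: HK; right|by apply: nKH => X /KH HX; right].
rewrite /P/=; suff -> : G `|` K = K by [].
by apply/setUidPr => X GX; apply: HK; left.
Qed.

(* Ellis: the filters [M e] and [M] intersected with [{m | m e = e}] refine a
   maximal [M], hence equal it. *)
Lemma semigroup_filter_idempotent G : semigroup_filter G ->
  exists e, [/\ UltraFilter e, ultra_mul e e = e & G `<=` e].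
Proof.
move=> /max_semigroup_filter[M [MS GM Mmax]]; have [MP Mmul] := MS.
have [e [eU Me]] := ultraFilterLemma MP.
have M_sub_Me : M `<=` ultra_mul M e.
  by move=> A MA; apply: (@filter_ultraP _ M) => r rU Mr; exact: (Mmul r e).
have MeE : ultra_mul M e = M.
  apply: Mmax => //; split; first exact: ultra_mul_proper.
  move=> p q pU qU Mep Meq A MeA.
  (* Solve [m e = q] with [m] refining [M]; then [p q = (p m) e], and [p m] refines [M] because [p]
     does. *)
  have [m [mU divm]] := ultraFilterLemma (rdiv_filter_proper MP eU qU Meq).
  have q_me : ultra_mul m e = q.
    apply: max_filter; first exact: ultra_mul_proper.
    exact: rdiv_filter_mul divm.
  rewrite -q_me -ultra_mulA; apply: (Mmul p m) => //.
  - by move=> B /M_sub_Me/Mep.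
  - by move=> B MB; exact/divm/rdiv_filter_sub.
(* As [M e = M] and [e] refines [M], the equation [m e = e] has a solution refining [M]. *)
have divP : ProperFilter (rdiv_filter M e e).
  by apply: rdiv_filter_proper; rewrite ?MeE.
have divE : rdiv_filter M e e = M.
  apply: Mmax; last exact: rdiv_filter_sub.
  split=> // p q pU qU divp divq X [[B A] [/= MB eA] BAX].
  apply: (@filterS _ _ (ultra_mul_filter _ _) _ _ BAX).
  apply: (@filterI _ _ (ultra_mul_filter _ _)).
    by apply: (Mmul p q) => // Y MY; [apply: divp|apply: divq];
      exact: rdiv_filter_sub.
  have peA : ultra_mul p e A by exact: (rdiv_filter_mul _ _ divp).
  suff : ultra_mul (ultra_mul p q) e A by [].
  rewrite ultra_mulA; apply: (@filterS _ p) peA => s.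
  exact: (rdiv_filter_mul _ _ divq).
exists e; split=> //; last by move=> A /GM/Me.
apply: max_filter; first exact: ultra_mul_proper.
by apply: (@rdiv_filter_mul M); rewrite ?divE.
Qed.

End UltraMul.

(** * Counting fibres and products of finite sets *)

Lemma card_fset_le_fibers (T U : choiceType) (f : T -> U) (b : nat)
    (X : {fset T}) :
  (forall (u : U) (Y : {fset T}), (forall x, x \in Y -> f x = u) ->
    (#|` Y| <= b)%N) ->
  (#|` X| <= #|` [fset f x | x in X]%fset| * b)%N.
Proof.
move=> fb; rewrite card_fset_sum1 (partition_big_imfset _ f).
rewrite [X in (_ <= X)%N](_ : _ = (\sum_(u <- [fset f x | x in X]%fset) b)%N).
  apply: leq_sum => u _.
  have <- : #|` [fset x in X | f x == u]%fset| = (\sum_(x <- X | f x == u) 1)%N.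
    by rewrite card_fset_sum1 big_fset.
  by apply: (fb u) => x; rewrite !inE/= => /andP[_ /eqP].
by rewrite big_const_seq iter_addn_0 count_predT mulnC.
Qed.

Lemma cardfsX (T U : choiceType) (X : {fset T}) (Y : {fset U}) :
  #|` (X `*` Y)%fset| = (#|` X| * #|` Y|)%N.
Proof.
rewrite card_fset_sum1 big_imfset2/=; last first.
  by move=> [x y] [x' y'] _ _ /= [-> ->].
rewrite (eq_bigr (fun=> #|` Y|)); last by move=> x _; rewrite -card_fset_sum1.
by rewrite big_const_seq iter_addn_0 count_predT mulnC.
Qed.

(** Weak right cancellation tested on finite parts of the fibres, so that the bound is an inequality
    in [nat]. *)
Definition finite_fibers (b : nat) (S : semigroupType) : Prop :=
  forall (t u : S) (X : {fset S}), (forall x, x \in X -> (x * t)%g = u) ->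
  (#|` X| <= b)%N.

Lemma wrc_finite_fibers b (S : semigroupType) :
  weakly_right_cancellative b S -> finite_fibers b S.
Proof.
move=> hS t u X Xtu; rewrite -(set_fsetK X); apply: geq_card_fset_set.
by apply: card_le_trans (hS t u); apply: subset_card_le => x /= /Xtu.
Qed.

Lemma finite_fibersX b c (S W : semigroupType) :
  finite_fibers b S -> finite_fibers c W ->
  finite_fibers (b * c) (S * W)%type.
Proof.
move=> hS hW [t t'] [u u'] X Xtu.
apply: (@leq_trans #|` ((fst @` X) `*` (snd @` X))%fset|).
  apply/fsubset_leq_card/fsubsetP => x xX.
  by rewrite inE; apply/andP; split; apply/imfsetP; exists x.
rewrite cardfsX leq_mul//; [apply: (hS t u)|apply: (hW t' u')];
  by move=> _ /imfsetP[x /= /Xtu xtu ->]; case: xtu.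
Qed.

(** * Traces and sets of positive upper Banach density *)

Definition trace (T : choiceType) (A : set T) (X : {fset T}) : {fset T} :=
  [fset x in X | x \in A]%fset.

Lemma traceP (T : choiceType) (A : set T) (X : {fset T}) (x : T) :
  reflect (x \in X /\ A x) (x \in trace A X).
Proof.
rewrite !inE/=; apply: (iffP andP) => -[xX xA]; split=> //.
  exact: set_mem.
exact: mem_set.
Qed.

Lemma card_trace_rtranslate (S : semigroupType) (A : set S) (X : {fset S})
  (s : option S) : (#|` trace A (rtranslate X s)| <= #|` X|)%N.
Proof.
apply: (@leq_trans #|` rtranslate X s|).
  by apply/fsubset_leq_card/fsubsetP => x /traceP[].
by case: s => [t|] //=; exact: leq_imfset_card.
Qed.

Section Large.
Context (R : realType) (S : semigroupType) (d : Order.disp_t)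
        (I : preorderType d) (F : I -> {fset S}).
Implicit Types (A B C : set S).

Definition large A : Prop :=
  exists2 alpha : R, 0 < alpha & upper_Banach_levels F A alpha.

Lemma upper_Banach_density_gt0 A : net_Pf F ->
  0 < upper_Banach_density R F A <-> large A.
Proof.
move=> hF; have supA := has_sup_upper_Banach_levels R A hF; split.
  (* The density itself serves as the margin below the supremum, so the level found exceeds 0. *)
  move=> d0; have [alpha Aalpha lt_alpha] := sup_adherent d0 supA.
  by exists alpha => //; rewrite subrr in lt_alpha.
by move=> [alpha a0 Aalpha]; apply: lt_le_trans a0 _; apply: sup_ubound => //;
  case: supA.
Qed.

Lemma large_sub A B : A `<=` B -> large A -> large B.
Proof.
move=> AB [alpha a0 Aa]; exists alpha => // i0.
have [i [i0i [s le_a]]] := Aa i0; exists i; split=> //; exists s.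
rewrite (le_trans le_a)// ler_nat; apply/fsubset_leq_card/fsubsetP => x.
by move=> /(@traceP _ A)[xF /AB Bx]; apply/(@traceP _ B).
Qed.

Lemma not_large0 : net_Pf F -> ~ large set0.
Proof.
move=> [[[i0] _] F0] [alpha a0 /(_ i0)[i [_ [s]]]].
apply/negP; rewrite -ltNge (_ : [fset x in _ | _]%fset = fset0).
  by rewrite cardfs0 mulr_gt0// ltr0n cardfs_gt0.
by apply/fsetP => x; rewrite in_fset0; apply/negP => /(@traceP _ set0)[].
Qed.

(** If both sets fail at level [alpha / 2], both traces are below half of [alpha] times the size of
    [F i] from a common index on, and the trace of the union is at most their sum. *)
Lemma large_setU A B : directed I -> large (A `|` B) -> large A \/ large B.
Proof.
move=> [_ dirI] [alpha a0 ABa]; apply: contrapT => /not_orP[nA nB].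
have a20 : 0 < alpha / 2 by rewrite divr_gt0.
have small C : ~ large C -> exists i0, forall i, (i0 <= i)%O -> forall s,
    #|` trace C (rtranslate (F i) s)|%:R < alpha / 2 * #|` F i|%:R.
  move=> nC; apply: contrapT => /forallNP nsmall; apply: nC.
  exists (alpha / 2) => // i0; have /existsNP[i /not_implyP[i0i]] := nsmall i0.
  move=> /existsNP[s /negP]; rewrite -leNgt => le_s.
  by exists i; split=> //; exists s.
have [i1 h1] := small A nA; have [i2 h2] := small B nB.
have [i0 [i10 i20]] := dirI i1 i2; have [i [i0i [s]]] := ABa i0.
apply/negP; rewrite -ltNge.
have := ltrD (h1 i (le_trans i10 i0i) s) (h2 i (le_trans i20 i0i) s).
rewrite -mulrDl -splitr; apply: le_lt_trans; rewrite -natrD ler_nat.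
set X := rtranslate _ _.
apply: (@leq_trans #|` (trace A X `|` trace B X)%fset|).
  apply/fsubset_leq_card/fsubsetP => x /(@traceP _ (A `|` B))[xX ABx].
  by rewrite in_fsetU; apply/orP; case: ABx => ?; [left|right]; apply/traceP.
by rewrite cardfsU leq_subr.
Qed.

(* [D*] is a right ideal: right translation by [x] moves a trace of [C] into a
   translate of the net, losing at most the factor [b]. *)
Lemma large_translate b A C : finite_fibers b S ->
  (forall X : {fset S}, (forall s, s \in X -> C s) ->
    exists x, forall s, s \in X -> A (s * x)%g) ->
  large C -> large A.
Proof.
(* Dividing by [b.+1] keeps the level positive for every [b]. *)
move=> hb CA [alpha a0 Ca]; exists (alpha / b.+1%:R) => [|i0].
  by rewrite divr_gt0.
have [i [i0i [s le_a]]] := Ca i0; exists i; split=> //.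
set X := trace C (rtranslate (F i) s).
have [x XA] : exists x, forall s, s \in X -> A (s * x)%g.
  by apply: CA => y /traceP[].
exists (Some (if s is Some t then t * x else x)%g).
rewrite mulrAC ler_pdivrMr//; apply: le_trans le_a _.
rewrite -natrM ler_nat.
apply: (@leq_trans (#|` [fset (y * x)%g | y in X]%fset| * b.+1)).
  apply: card_fset_le_fibers => u Y Yu.
  by apply: leqW; exact: (hb x u).
rewrite leq_mul2r/=; apply/fsubset_leq_card/fsubsetP => _ /imfsetP[y /= yX ->].
apply/(@traceP _ A); split; last exact: XA.
move: yX => /traceP[+ _]; rewrite /rtranslate; case: s {X XA} => [t|] /=.
  by move=> /imfsetP[z /= zF ->]; apply/imfsetP; exists z; rewrite //= mulgA.
by move=> yF; apply/imfsetP; exists y.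
Qed.

(** For finitely many [s] with [s^-1 A] in [q], the intersection of these sets is in [q], so it
    contains a common translating element [x]. *)
Lemma large_ultra_mul b (p q : set_system S) A : finite_fibers b S ->
  ProperFilter q -> (forall C, p C -> large C) -> ultra_mul p q A -> large A.
Proof.
move=> hb qF pl pqA; apply: (large_translate hb _ (pl _ pqA)) => X XA.
have /filter_ex[x Xx] : q (\bigcap_(s in [set` X]) [set t | A (s * t)%g]).
  by apply: filter_bigI => s /XA.
by exists x => s sX; exact: Xx.
Qed.

End Large.

(** * Density of rectangles for the product net *)

Section Product.
Context (R : realType) (S W : monoidType) (dI dJ : Order.disp_t)
  (I : preorderType dI) (J : preorderType dJ)
  (E : I -> {fset S}) (F : J -> {fset W}).

(** Replaces the adjoined identity by the actual one, so that translations of the two factors always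
    pair into one of the product. *)
Lemma rtranslate_Some (M : monoidType) (X : {fset M}) (s : option M) :
  exists t : M, rtranslate X s = rtranslate X (Some t).
Proof.
case: s => [t|]; first by exists t.
exists 1%g; apply/fsetP => x; apply/idP/imfsetP => /= [xX|[y yX ->]].
  by exists x; rewrite ?mulg1.
by rewrite mulg1.
Qed.

Lemma card_trace_product (i : I) (j : J) (s : S) (w : W) C D :
  #|` trace (C `*` D) (rtranslate (product_net E F (i, j)) (Some (s, w)))| =
  (#|` trace C (rtranslate (E i) (Some s))| *
   #|` trace D (rtranslate (F j) (Some w))|)%N.
Proof.
rewrite -cardfsX; congr #|` _|; apply/fsetP => -[x y].
rewrite in_fsetM/=; apply/traceP/andP => /=.
  move=> [/imfsetP[[x' y'] /=]]; rewrite in_fsetM/= => /andP[x'E y'F] [-> ->].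
  by move=> [Cx Dy]; split; apply/traceP; split=> //; apply/imfsetP;
    [exists x'|exists y'].
move=> [/traceP[/imfsetP[x' /= x'E ->] Cx] /traceP[/imfsetP[y' /= y'F ->] Dy]].
by split=> //; apply/imfsetP; exists (x', y'); rewrite //= in_fsetM/= x'E.
Qed.

Lemma product_net_Pf : net_Pf E -> net_Pf F -> net_Pf (product_net E F).
Proof.
move=> [[[i0] dirI] E0] [[[j0] dirJ] F0]; split; first split.
- by constructor; exact: (i0, j0).
- move=> [i j] [i' j']; have [i2 [ii ii']] := dirI i i'.
  have [j2 [jj jj']] := dirJ j j'; exists (i2, j2).
  by rewrite !leEprod/= ii ii' jj jj'.
- move=> [i j]; rewrite -cardfs_gt0 cardfsX muln_gt0 !cardfs_gt0.
  by rewrite E0 F0.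
Qed.

(** Counts on rectangles multiply, hence so do the levels. *)
Lemma large_setX C D : large R E C -> large R F D ->
  large R (product_net E F) (C `*` D).
Proof.
move=> [a a0 Ca] [b b0 Db]; exists (a * b); first exact: mulr_gt0.
move=> [i0 j0]; have [i [i0i [s]]] := Ca i0; have [j [j0j [w]]] := Db j0.
have [s' ->] := rtranslate_Some (E i) s.
have [w' ->] := rtranslate_Some (F j) w => le_b le_a.
exists (i, j); rewrite leEprod/= i0i j0j; split=> //; exists (Some (s', w')).
have /= -> := card_trace_product i j s' w' C D.
rewrite cardfsX !natrM mulrACA ler_pM// mulr_ge0// ?ltW//.
Qed.

(** The level is kept: the second factor of the count is at most the size of [F j], which
    cancels. *)
Lemma large_setX_fst C D : net_Pf F ->
  large R (product_net E F) (C `*` D) -> large R E C.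
Proof.
move=> [[[j0] _] F0] [a a0 CDa]; exists a => // i0.
have [[i j] []] := CDa (i0, j0); rewrite leEprod/= => /andP[i0i _] [o].
have [[s w] ->] := rtranslate_Some (product_net E F (i, j)) o.
rewrite [X in _ <= X%:R](card_trace_product i j s w C D) => le_a.
exists i; split=> //; exists (Some s).
have Fj0 : 0 < #|` F j|%:R :> R by rewrite ltr0n cardfs_gt0.
rewrite -(ler_pM2r Fj0) -mulrA -natrM -cardfsX (le_trans le_a)//.
rewrite -natrM ler_nat leq_mul2l; apply/orP; right.
exact: card_trace_rtranslate.
Qed.

Lemma large_setX_snd C D : net_Pf E ->
  large R (product_net E F) (C `*` D) -> large R F D.
Proof.
move=> [[[i0] _] E0] [a a0 CDa]; exists a => // j0.
have [[i j] []] := CDa (i0, j0); rewrite leEprod/= => /andP[_ j0j] [o].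
have [[s w] ->] := rtranslate_Some (product_net E F (i, j)) o.
rewrite [X in _ <= X%:R](card_trace_product i j s w C D) => le_a.
exists j; split=> //; exists (Some w).
have Ei0 : 0 < #|` E i|%:R :> R by rewrite ltr0n cardfs_gt0.
rewrite -(ler_pM2l Ei0) mulrCA -natrM -cardfsX (le_trans le_a)//.
rewrite -natrM ler_nat leq_mul2r; apply/orP; right.
exact: card_trace_rtranslate.
Qed.

End Product.

(** * Idempotents under homomorphisms, and the equivalence *)

Lemma fmap_ultra_mul (S T : semigroupType) (f : S -> T) (p : set_system S) :
  {morph f : x y / (x * y)%g} -> ultra_mul p p = p ->
  ultra_mul (f @ p) (f @ p) = f @ p.
Proof.
move=> fM pp; rewrite predeqE => A.
suff <- : ultra_mul p p (f @^-1` A) = ultra_mul (f @ p) (f @ p) A by rewrite pp.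
rewrite /ultra_mul/=; congr p; rewrite funeqE => s /=; congr p.
by rewrite funeqE => t /=; rewrite fM.
Qed.

Theorem theorem5p8 (R : realType) (b : nat) (hb : (0 < b)%N)
  (S W : monoidType)
  (hS : weakly_right_cancellative b S) (hW : weakly_right_cancellative b W)
  (dI dJ : Order.disp_t) (I : preorderType dI) (J : preorderType dJ)
  (E : I -> {fset S}) (F : J -> {fset W})
  (hE : net_Pf E) (hF : net_Pf F)
  (A : set S) (B : set W) :
  Dset R (product_net E F) (A `*` B) <-> Dset R E A /\ Dset R F B.
Proof.
have hEF := product_net_Pf hE hF; split.
  move=> [p [pU pp [_ pD] pAB]].
  have pl C : p C -> large R (product_net E F) C.
    by move=> /pD /(upper_Banach_density_gt0 R C hEF).
  split.
    exists (fst @ p); split.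
    - exact: fmap_ultra.
    - exact: fmap_ultra_mul.
    - split; first exact: fmap_ultra.
      move=> C pC; apply/(upper_Banach_density_gt0 R C hE).
      apply: (large_setX_fst (D := setT) hF).
      by apply: pl; apply: (@filterS _ p) pC => -[].
    - by apply: (@filterS _ p) pAB => -[x y] [].
  exists (snd @ p); split.
  - exact: fmap_ultra.
  - exact: fmap_ultra_mul.
  - split; first exact: fmap_ultra.
    move=> C pC; apply/(upper_Banach_density_gt0 R C hF).
    apply: (large_setX_snd (C := setT) hE).
    by apply: pl; apply: (@filterS _ p) pC => -[].
  - by apply: (@filterS _ p) pAB => -[x y] [].
move=> [[p [pU pp [_ pD] pA]] [q [qU qq [_ qD] qB]]].
have hSW := finite_fibersX (wrc_finite_fibers hS) (wrc_finite_fibers hW).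
(* [G] consists of the sets containing some [C * D] up to a null set; the ultrafilters refining it
   are those of [D*] that project to [p] and [q]. *)
pose G : set_system (S * W) := [set X | exists C D,
  [/\ p C, q D & ~ large R (product_net E F) (C `*` D `\` X)]].
have GX C D : p C -> q D -> G (C `*` D).
  move=> pC qD'; exists C, D; split=> //; rewrite setDv; exact: not_large0.
have Glarge r : UltraFilter r -> G `<=` r -> forall X, r X ->
    large R (product_net E F) X.
  move=> rU Gr X rX; apply: contrapT => nX.
  (* The complement of a null set is in [G]: the whole product exceeds it only by that null set. *)
  apply: (@ultra_disjoint _ r X) => //; apply: Gr; exists setT, setT.
  split; try exact: filterT.
  by move=> lX; apply: nX; apply: large_sub lX => x [_ /contrapT].
have GS : semigroup_filter G.
  split.
    split.
      move=> [C [D [pC qD' nCD]]]; apply: nCD; rewrite setD0.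
      by apply: large_setX; [apply/(upper_Banach_density_gt0 R C hE)/pD|
                             apply/(upper_Banach_density_gt0 R D hF)/qD].
    split.
    - by rewrite -setXTT; apply: GX; exact: filterT.
    - move=> X Y [C [D [pC qD' nX]]] [C' [D' [pC' qD'' nY]]].
      exists (C `&` C'), (D `&` D'); split; try exact: filterI.
      move=> lXY; suff : large R (product_net E F)
          (((C `*` D) `\` X) `|` ((C' `*` D') `\` Y)).
        by move=> /(large_setU hEF.1)[].
      apply: large_sub lXY => -[x y] /= [[[Cx C'x] [Dy D'y]]].
      move=> /not_andP[nX'|nY'].
        by left.
      by right.
    - move=> X Y XY [C [D [pC qD' nX]]]; exists C, D; split=> // lY.
      by apply: nX; apply: large_sub lY => x [CDx nYx]; split=> // /XY.
  move=> r1 r2 r1U r2U Gr1 Gr2 X [C [D [pC qD' nX]]].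
  have rU := ultra_mul_ultra r1U r2U; have rP := @ultra_proper _ _ rU.
  (* [X] contains [C * D] minus a null set. The null set is not in [r1 r2], by the right ideal
     property; the rectangle remains. *)
  apply: (@filterS _ (ultra_mul r1 r2) _ ((C `*` D) `&` ~` ((C `*` D) `\` X))).
    by move=> x [CDx nCDX]; apply: contrapT => nXx; exact: nCDX.
  apply: filterI; last first.
    have [rN|//] := in_ultra_setVsetC ((C `*` D) `\` X) rU.
    exfalso; apply: nX; apply: (large_ultra_mul hSW _ _ rN) => Z.
    exact: (Glarge r1).
  (* Since [C] is in [p p] and [D] in [q q], the pairs [(s, w)] with [s^-1 C] in [p] and [w^-1 D] in
     [q] form a rectangle in [G], and each gives a rectangle [s^-1 C * w^-1 D] in [G]. *)
  rewrite -pp in pC; rewrite -qq in qD'.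
  apply: filterS (Gr1 _ (GX _ _ pC qD')) => -[s w] [/= pCs qDw].
  by apply: filterS (Gr2 _ (GX _ _ pCs qDw)) => -[t v].
have [r [rU rr Gr]] := semigroup_filter_idempotent GS.
exists r; split=> //; last exact/Gr/GX.
split=> // X rX; apply/(upper_Banach_density_gt0 R X hEF); exact: Glarge rX.
Qed.
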